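(* If every $2^{d-1}(2d-1)$ (or fewer) members of a collection of $*$-boxes in $\mathbb{R}^d$ admit a $*$-transversal by a $(d-2)$-flat, then there is a $(d-2)$-flat $*$-transversal to all the $*$-boxes.
   Context: All flats are flats in real projective space $\mathbb{RP}^d\supset\mathbb{R}^d$ that do not meet the origin of $\mathbb{R}^d$. Each hyperplane not containing the origin has a unique equation $a\cdot z=\sum_ia_iz_i=1$, where $z_1,\dots,z_d$ are the coordinates of $\mathbb{R}^d$; the coefficients $a=(a_1,\dots,a_d)$ are coordinates for the hyperplane, with $(0,\dots,0)$ giving the hyperplane at infinity. Such hyperplanes are partially ordered by componentwise comparison of these coordinates. The $*$-box between two hyperplanes $A\le B$ not containing the origin is the set of hyperplanes $H$ not containing the origin with $A\le H\le B$. A $(d-2)$-flat not containing the origin is $*$-transverse to (a $*$-transversal of) a $*$-box if it lies on some hyperplane $H$ in the $*$-box. It is a $*$-transversal to a collection of $*$-boxes if it is $*$-transverse to each of them. *)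

(* Defs.v *)
From mathcomp Require Import all_boot all_order all_algebra.
From mathcomp Require Import all_classical all_reals.

Set Implicit Arguments.
Unset Strict Implicit.
Unset Printing Implicit Defensive.

Import Order.TTheory GRing.Theory Num.Theory.
Local Open Scope classical_set_scope.
Local Open Scope ring_scope.

(* RP^d is the projectivization of R^(d+1) = 'rV[R]_(d + 1);
   z in R^d is the projective point spanned by (z, 1), and the points spanned
   by (z, 0) are at infinity. A flat of RP^d is a linear subspace V, of
   projective dimension \dim V - 1 (the empty flat, V = 0, has dimension -1). *)

Definition flat (R : realType) (d : nat) := {vspace 'rV[R]_(d + 1)}.

Definition proj_dim (R : realType) (d : nat) (L : flat R d) : int :=
  (\dim L)%:Z - 1.

Definition affine_pt (R : realType) (d : nat) (z : 'rV[R]_d) : 'rV[R]_(d + 1) :=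
  row_mx z 1%:M.

Definition avoids_origin (R : realType) (d : nat) (L : flat R d) : Prop :=
  affine_pt 0 \notin L.

(* Homogenization of a . z = 1: the (z, t) with a . z - t = 0. *)
Definition hyperplane (R : realType) (d : nat) (a : 'rV[R]_d) : flat R d :=
  lker (linfun (mulmxr (col_mx a^T (- 1%:M))) : 'Hom('rV[R]_(d + 1), 'M[R]_1)).

Definition coord_le (R : realType) (d : nat) (a b : 'rV[R]_d) : Prop :=
  forall i, a 0 i <= b 0 i.

Definition starbox (R : realType) (d : nat) (a b : 'rV[R]_d) : set (flat R d) :=
  [set hyperplane h | h in [set h | coord_le a h /\ coord_le h b]].

Definition is_starbox (R : realType) (d : nat) (X : set (flat R d)) : Prop :=
  exists a b, coord_le a b /\ X = starbox a b.

Definition star_transverse (R : realType) (d : nat) (L : flat R d)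
    (X : set (flat R d)) : Prop :=
  exists2 H, X H & (L <= H)%VS.

Definition star_transversal (R : realType) (d : nat) (L : flat R d)
    (F : set (set (flat R d))) : Prop :=
  [/\ proj_dim L = d%:Z - 2, avoids_origin L
    & forall X, F X -> star_transverse L X].

(* [hyperplane a] meets R^d in a . z = 1, and a |-> hyperplane a is a bijection
   onto the hyperplanes of RP^d that avoid the origin. *)

Lemma mem_hyperplane (R : realType) (d : nat) (a z : 'rV[R]_d) (t : R) :
  (row_mx z t%:M \in hyperplane a) = (\sum_i a 0 i * z 0 i == t).
Proof.
rewrite memv_ker lfunE /= mul_row_col mulmxN mulmx1 subr_eq0.
have -> : z *m a^T = (\sum_i a 0 i * z 0 i)%:M.
  rewrite [LHS]mx11_scalar !mxE; congr (_%:M).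
  by apply: eq_bigr => i _; rewrite mxE mulrC.
by apply/eqP/eqP => [/matrixP /(_ 0 0)|->//]; rewrite !mxE eqxx.
Qed.

Lemma affine_pt_hyperplane (R : realType) (d : nat) (a z : 'rV[R]_d) :
  (affine_pt z \in hyperplane a) = (\sum_i a 0 i * z 0 i == 1).
Proof. exact: mem_hyperplane. Qed.

Lemma hyperplane_avoids_origin (R : realType) (d : nat) (a : 'rV[R]_d) :
  avoids_origin (hyperplane a).
Proof.
rewrite /avoids_origin affine_pt_hyperplane big1 => [|i _].
  by rewrite eq_sym oner_eq0.
by rewrite mxE mulr0.
Qed.

Lemma hyperplane_inj (R : realType) (d : nat) :
  injective (@hyperplane R d).
Proof.
move=> a b eqab; apply/rowP => j.
have dot (c : 'rV[R]_d) : \sum_i c 0 i * (delta_mx 0 j : 'rV[R]_d) 0 i = c 0 j.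
  rewrite (bigD1 j) //= big1 ?addr0 => [|i ij]; rewrite !mxE !eqxx ?mulr1 //.
  by rewrite (negbTE ij) mulr0.
have := mem_hyperplane a (delta_mx 0 j) (a 0 j).
by rewrite eqab mem_hyperplane !dot eqxx => /eqP.
Qed.

Lemma proj_dim_hyperplane (R : realType) (d : nat) (a : 'rV[R]_d) :
  proj_dim (hyperplane a) = d%:Z - 1.
Proof.
rewrite /proj_dim; congr (_%:Z - 1).
pose f : 'Hom('rV[R]_(d + 1), 'M[R]_1) :=
  linfun (mulmxr (col_mx a^T (- 1%:M))).
have := limg_ker_dim f fullv; rewrite capfv !dimvf -[lker f]/(hyperplane a).
have -> : \dim (limg f) = 1%N.
  apply/eqP; rewrite eqn_leq; apply/andP; split.
    by have := dimvS (subvf (limg f)); rewrite dimvf.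
  rewrite lt0n dimv_eq0 -subv0; apply/negP => f0.
  have := hyperplane_avoids_origin a; rewrite /avoids_origin memv_ker.
  by rewrite -memv0 (subvP f0) // memv_img // memvf.
by rewrite /dim /= mul1n => /addIn.
Qed.

Lemma hyperplane_surj (R : realType) (d : nat) (H : flat R d) :
  proj_dim H = d%:Z - 1 -> avoids_origin H -> exists a, H = hyperplane a.
Proof.
move=> dimH H0.
have {}dimH : \dim H = d by move/addIr: dimH => [].
have o_neq0 : affine_pt (0 : 'rV[R]_d) != 0.
  by apply: contraNneq H0 => ->; rewrite mem0v.
have cap0 : (H :&: <[affine_pt 0]> = 0)%VS.
  apply/eqP; rewrite -subv0; apply/subvP => v; rewrite memv_cap => /andP[vH].
  case/vlineP => k vE; move: vH; rewrite {}vE memv0.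
  have [->|k0] := eqVneq k 0; first by rewrite scale0r.
  by rewrite rpredZeq (negbTE k0) (negbTE H0).
have sumT : (H + <[affine_pt 0]> = fullv)%VS.
  apply/eqP; rewrite eqEdim subvf dimvf /= dimv_disjoint_sum // dim_vline.
  by rewrite o_neq0 dimH /dim /= mul1n.
have ht i : exists t : R, row_mx (delta_mx 0 i : 'rV[R]_d) t%:M \in H.
  have : row_mx (delta_mx 0 i : 'rV[R]_d) (0 : R)%:M \in (H + <[affine_pt 0]>)%VS.
    by rewrite sumT memvf.
  case/memv_addP => u uH [w /vlineP[k ->] e].
  exists (- k); suff -> : row_mx (delta_mx 0 i) (- k)%:M = u by [].
  move/eqP: e; rewrite -subr_eq => /eqP <-; rewrite /affine_pt scale_row_mx.
  by rewrite opp_row_mx add_row_mx scaler0 subr0 scale_scalar_mx mulr1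
             raddf0 add0r raddfN.
pose a : 'rV[R]_d := \row_i xget 0 [set t | row_mx (delta_mx 0 i) t%:M \in H].
have aH i : row_mx (delta_mx 0 i) (a 0 i)%:M \in H.
  by rewrite mxE; case: (ht i) => t tH; case: xgetP => [? -> //|/(_ t)].
exists a; clearbody a; apply/eqP; rewrite eq_sym eqEdim; apply/andP; split; last first.
  have := proj_dim_hyperplane a; rewrite /proj_dim => /addIr[] ->.
  by rewrite dimH.
apply/subvP => v; rewrite -[v]hsubmxK [rsubmx v]mx11_scalar mem_hyperplane.
move: (lsubmx v) (rsubmx v 0 0) => z t /eqP <- {v t}.
have -> : row_mx z (\sum_i a 0 i * z 0 i)%:M
    = \sum_i z 0 i *: row_mx (delta_mx 0 i) (a 0 i)%:M.
  apply/rowP => j; rewrite summxE; case: (split_ordP j) => k ->.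
    rewrite row_mxEl (bigD1 k) //= big1 => [|i ik].
      by rewrite [RHS]addr0 [RHS]mxE row_mxEl mxE !eqxx mulr1.
    by rewrite mxE row_mxEl mxE [k == i]eq_sym (negbTE ik) mulr0.
  rewrite row_mxEr ord1 mxE eqxx mulr1n; apply: eq_bigr => i _.
  by rewrite mxE row_mxEr mxE eqxx mulr1n mulrC.
by apply: memv_suml => i _; apply: memvZ.
Qed.

(* Main.v *)
Require Import Defs.
From HB Require Import structures.
From mathcomp Require Import all_boot all_order all_algebra.
From mathcomp Require Import all_classical all_reals.
From mathcomp Require Import finmap topology normedtype.
From mathcomp Require Import ring lra zify.

Set Implicit Arguments.
Unset Strict Implicit.
Unset Printing Implicit Defensive.

Import Order.TTheory GRing.Theory Num.Theory.
Import numFieldNormedType.Exports.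

Local Open Scope classical_set_scope.
Local Open Scope card_scope.
Local Open Scope ring_scope.

(* By duality, the hyperplanes through a (d-2)-flat that avoids the origin have
   their coefficient vectors on a line of R^d, and every line arises in this way;
   so this is Santalo's theorem on lines meeting axis-parallel boxes.
   Up to a reflection, a line with no zero direction coordinate is increasing; it
   is then described by t = al_i x_i + be_i with al_i > 0, where al_0 = 1 and
   be_0 = 0, and it meets the box [a, b] iff
   al_i a_i + be_i <= al_j b_j + be_j for all i, j. These conditions are linear in
   2(d-1) unknowns, so Helly's theorem gives the Helly number 2d-1 for each of
   the 2^(d-1) sign patterns of the direction. Directions with zero coordinates
   are reached by fattening the boxes and a compactness argument. *)

(** * Convex sets: Radon's lemma and Helly's theorem *)

Definition convex (R : realFieldType) (V : lmodType R) (C : set V) :=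
  forall x y s t, 0 < s -> 0 < t -> s + t = 1 ->
    C x -> C y -> C (s *: x + t *: y).

Lemma convex_barycenter (R : realFieldType) (V : lmodType R) (C : set V)
    (I : finType) (P : pred I) (w : I -> R) (x : I -> V) :
  convex C -> (forall i, P i -> 0 <= w i) -> (forall i, P i -> C (x i)) ->
  0 < \sum_(i | P i) w i ->
  C ((\sum_(i | P i) w i)^-1 *: \sum_(i | P i) w i *: x i).
Proof.
move=> cvxC w0 Cx.
(* The cone over C at height 1, completed by its apex, is stable by sums. *)
pose cone (l : R) (y : V) := (l = 0 /\ y = 0) \/ (0 < l /\ C (l^-1 *: y)).
suff: cone (\sum_(i | P i) w i) (\sum_(i | P i) w i *: x i).
  by case=> [[-> _]|[]//]; rewrite ltxx.
apply: (big_rec2 cone) => [|i l y Pi]; first by left.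
have [wi0|wi0] := eqVneq (w i) 0; rewrite ?wi0 ?scale0r ?add0r //.
have wi_gt0 : 0 < w i by rewrite lt0r wi0 w0.
case=> [[-> ->]|[l0 Cy]]; right.
  by rewrite !addr0 scalerA mulVf// scale1r; split=> //; apply: Cx.
have wl0 : 0 < w i + l by rewrite addr_gt0.
split=> //; have -> : (w i + l)^-1 *: (w i *: x i + y) =
    (w i / (w i + l)) *: x i + (l / (w i + l)) *: (l^-1 *: y).
  rewrite scalerDr !scalerA [in LHS]mulrC [l / _]mulrC.
  by rewrite (mulfK (lt0r_neq0 l0)).
apply: cvxC; rewrite ?divr_gt0//; last exact: Cx.
by rewrite -mulrDl divff// lt0r_neq0.
Qed.

(** With a coordinate 1 appended, the points are more than n + 1 vectors in dimension n + 1; a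
    linear relation between them is an affine dependence. *)
Lemma affine_dependence (F : fieldType) (n N : nat) (x : 'I_N -> 'rV[F]_n) :
  (n.+1 < N)%N ->
  exists w : 'I_N -> F,
    [/\ exists i, w i != 0, \sum_i w i = 0 & \sum_i w i *: x i = 0].
Proof.
move=> nN; pose A := \matrix_(i < N) row_mx (x i) (1%:M : 'M_1).
have : kermx A != 0.
  rewrite -mxrank_eq0 mxrank_ker -lt0n subn_gt0.
  by rewrite (leq_ltn_trans (rank_leq_col A))// addn1.
case/rowV0Pn => v /sub_kermxP vA v0.
have vE : row_mx (\sum_i v 0 i *: x i) (\sum_i v 0 i)%:M = 0 :> 'rV_(n + 1).
  rewrite -[RHS]vA mulmx_sum_row.
  under [RHS]eq_bigr do rewrite rowK scale_row_mx scale_scalar_mx mulr1.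
  apply/rowP => j; rewrite summxE; case: (split_ordP j) => k ->.
    by rewrite row_mxEl summxE; apply: eq_bigr => i _; rewrite row_mxEl.
  rewrite row_mxEr ord1 mxE eqxx mulr1n; apply: eq_bigr => i _.
  by rewrite row_mxEr mxE eqxx mulr1n.
exists (v 0); split.
- by case/rV0Pn: v0 => i; exists i.
- by move/(congr1 rsubmx)/matrixP/(_ 0 0): vE; rewrite row_mxKr !mxE eqxx.
- by move/(congr1 lsubmx): vE; rewrite row_mxKl raddf0.
Qed.

(** Moving the negative weights of an affine dependence to the other side exhibits one point as a
    barycenter of both classes. Quantifying over convex sets avoids speaking of convex hulls. *)
Lemma radon (R : realFieldType) (n N : nat) (x : 'I_N -> 'rV[R]_n) :
  (n.+1 < N)%N ->
  exists (J : pred 'I_N) (z : 'rV[R]_n),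
    forall C : set 'rV[R]_n, convex C ->
      ((forall i, J i -> C (x i)) \/ (forall i, ~~ J i -> C (x i))) -> C z.
Proof.
move=> /(affine_dependence x)[w [[k wk] w_sum wx_sum]].
pose J i := 0 < w i; pose S := \sum_(i | J i) w i.
have SN : \sum_(i | ~~ J i) - w i = S.
  by apply/eqP; rewrite sumrN eq_sym -addr_eq0 -[eqbRHS]w_sum [eqbRHS](bigID J).
have S0 : 0 < S.
  rewrite lt0r sumr_ge0 ?andbT; last by move=> i /ltW.
  apply: contra wk => /eqP S0; have [wk0|] := boolP (J k).
    by move/psumr_eq0P : S0 => -> // i /ltW.
  move: SN; rewrite S0 => /psumr_eq0P SN Jk.
  rewrite -oppr_eq0 SN// => i; rewrite /J -leNgt => ?.
  by rewrite oppr_ge0.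
exists J, (S^-1 *: \sum_(i | J i) w i *: x i) => C cvxC [CJ|CnJ].
  by apply: convex_barycenter => // i /ltW.
have -> : \sum_(i | J i) w i *: x i = \sum_(i | ~~ J i) (- w i) *: x i.
  under [RHS]eq_bigr do rewrite scaleNr.
  by apply/eqP; rewrite sumrN -addr_eq0 -[eqbRHS]wx_sum [eqbRHS](bigID J).
rewrite -SN; apply: convex_barycenter => //; last by rewrite SN.
by move=> i; rewrite oppr_ge0 /J -leNgt.
Qed.

(** Induction on the number of sets. Radon's lemma is applied to points [x i] common to all sets but
    the i-th: [C j] contains the whole Radon class to which j does not belong. *)
Lemma helly_ord (R : realFieldType) (n N : nat) (C : 'I_N -> set 'rV[R]_n) :
  (forall i, convex (C i)) ->
  (forall f : 'I_n.+1 -> 'I_N, exists x, forall k, C (f k) x) ->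
  exists x, forall i, C i x.
Proof.
elim: N C => [|N IH] C cvxC CI; first by exists 0 => -[].
have [Nn|nN] := leqP N n.
  (* With at most n + 1 sets, a single choice function, possibly with repetitions, lists them
     all. *)
  have [x Cx] := CI (fun k => inord k); exists x => i.
  have := Cx (widen_ord (leq_trans (leqnn _) Nn : (N.+1 <= n.+1)%N) i).
  by rewrite /= inord_val.
have /choice[x Cx] i : exists x, forall j, j != i -> C j x.
  have [||x Cx] := IH (C \o lift i).
  - by move=> j; apply: cvxC.
  - by move=> f; have [x Cx] := CI (lift i \o f); exists x.
  exists x => j ji; have [k ->|] := unliftP i j; first exact: Cx.
  by move/eqP; rewrite (negbTE ji).
have [J [z Cz]] := radon x (nN : (n.+1 < N.+1)%N).
exists z => j; apply: Cz => //; have [Jj|nJj] := boolP (J j).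
  by right=> i nJi; apply: Cx; apply: contraNneq nJi => <-.
by left=> i Ji; apply: Cx; apply: contraNneq nJj => ->.
Qed.

Lemma helly (R : realFieldType) (n : nat) (T : eqType) (C : T -> set 'rV[R]_n)
    (s : seq T) :
  (forall t, convex (C t)) ->
  (forall f : 'I_n.+1 -> T, (forall k, f k \in s) ->
    exists x, forall k, C (f k) x) ->
  exists x, forall t, t \in s -> C t x.
Proof.
move=> cvxC CI.
have [||x Cx] := @helly_ord R n _ (C \o tnth (in_tuple s)).
- by move=> i; apply: cvxC.
- by move=> f; apply: CI => k; apply: mem_tnth.
by exists x => t /(@tnthP _ _ (in_tuple s))[i ->]; apply: Cx.
Qed.

(** * Lines with positive direction and axis-parallel boxes *)

Definition line_meets_box (R : realType) (d : nat) (p u a b : 'rV[R]_d) : Prop :=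
  exists t, coord_le a (p + t *: u) /\ coord_le (p + t *: u) b.

(** Each lower bound on the parameter must be at most each upper bound. With denominators cleared, a
    coordinate with [u 0 i = 0], paired with a positive one, yields the constraint that [p 0 i] lies
    between [a 0 i] and [b 0 i]. *)
Lemma line_meets_boxP (R : realType) (d : nat) (p u a b : 'rV[R]_d) :
  (forall i, 0 <= u 0 i) -> (exists i, 0 < u 0 i) ->
  line_meets_box p u a b <->
  forall i j, u 0 j * (a 0 i - p 0 i) <= u 0 i * (b 0 j - p 0 j).
Proof.
move=> u0 [k uk]; split=> [[t [at_ tb]] i j|ab].
  apply: (@le_trans _ _ (u 0 j * (t * u 0 i))).
    by rewrite ler_wpM2l// lerBlDl; have := at_ i; rewrite !mxE.
  rewrite [leLHS]mulrCA [u 0 j * _]mulrC mulrCA ler_wpM2l//.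
  by rewrite lerBrDl; have := tb j; rewrite !mxE.
(* The parameter is the largest lower bound over the coordinates of positive direction. *)
have [i ui tmax] := @arg_maxP _ _ _ k (fun i => 0 < u 0 i)
  (fun i => (a 0 i - p 0 i) / u 0 i) uk.
exists ((a 0 i - p 0 i) / u 0 i); split=> j; rewrite !mxE.
  have [uj|] := ltP 0 (u 0 j).
    by rewrite -lerBlDl -ler_pdivrMr//; apply: tmax.
  rewrite -lerBlDl => uj; have {uj}uj : u 0 j = 0.
    by apply/le_anti; rewrite uj u0.
  by have := ab j i; rewrite uj mul0r mulr0 pmulr_rle0.
rewrite -lerBrDl mulrAC ler_pdivrMr// mulrC [leRHS]mulrC; exact: ab.
Qed.

Lemma helly_positive_lines (R : realType) (d : nat) (T : eqType)
    (a b : T -> 'rV[R]_d.+1) (s : seq T) :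
  (forall f : 'I_(d + d).+1 -> T, (forall k, f k \in s) ->
    exists p u : 'rV[R]_d.+1, (forall i, 0 < u 0 i) /\
      forall k, line_meets_box p u (a (f k)) (b (f k))) ->
  exists p u : 'rV[R]_d.+1, (forall i, 0 < u 0 i) /\
    forall t, t \in s -> line_meets_box p u (a t) (b t).
Proof.
move=> fs.
(* Positivity of [al] is read off from membership in some [C t0], so the empty list is settled
   apart. *)
have [->|[t0 t0s]] : s = [::] \/ exists t, t \in s.
- by case: s {fs} => [|t s]; [left|right; exists t; rewrite mem_head].
- by exists 0, (const_mx 1); split=> // i; rewrite mxE.
(* The two halves of [x] are the free coefficients at positive indices; index 0 is normalized to 1
   and 0. This leaves 2d unknowns in dimension d + 1. *)
pose al (x : 'rV[R]_(d + d)) : 'rV_(1 + d) := row_mx 1%:M (lsubmx x).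
pose be (x : 'rV[R]_(d + d)) : 'rV_(1 + d) := row_mx 0 (rsubmx x).
pose C t : set 'rV[R]_(d + d) := [set x | (forall i, 0 < al x 0 i) /\
  forall i j, al x 0 i * a t 0 i + be x 0 i <= al x 0 j * b t 0 j + be x 0 j].
have alE x y m n i : m + n = 1 ->
    al (m *: x + n *: y) 0 i = m * al x 0 i + n * al y 0 i.
  move=> mn; rewrite /al; case: (split_ordP i) => k ->; last first.
    by rewrite !row_mxEr !mxE.
  by rewrite !row_mxEl !ord1 !mxE eqxx /= !mulr1.
have beE x y m n i : be (m *: x + n *: y) 0 i = m * be x 0 i + n * be y 0 i.
  rewrite /be; case: (split_ordP i) => k ->.
    by rewrite !row_mxEl !mxE !mulr0 addr0.
  by rewrite !row_mxEr !mxE.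
have cvxC t : convex (C t).
  move=> x y m n m0 n0 mn [x0 Cx] [y0 Cy]; split=> [i|i j].
    by rewrite alE// addr_gt0// mulr_gt0.
  rewrite !alE// !beE.
  have := lerD (ler_wpM2l (ltW m0) (Cx i j)) (ler_wpM2l (ltW n0) (Cy i j)).
  by rewrite !mulrDr !mulrDl; lra.
have [f /fs[p [u [u0 pu]]]|x Cx] := helly cvxC (s := s).
  (* Along the line z = p + t u, these satisfy z_0 = r_i z_i + q_i. *)
  pose r i := u 0 0 / u 0 i; pose q i := p 0 0 - r i * p 0 i.
  have u_ge0 i : 0 <= u 0 i by apply/ltW.
  have r0 i : 0 < r i by rewrite divr_gt0.
  have l0 : lshift d (0 : 'I_1) = (0 : 'I_d.+1) by apply/val_inj.
  pose x : 'rV[R]_(d + d) :=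
    row_mx (\row_k r (rshift 1 k)) (\row_k q (rshift 1 k)).
  have ax i : al x 0 i = r i.
    rewrite /al row_mxKl; case: (split_ordP i) => k ->.
      by rewrite row_mxEl ord1 mxE eqxx /r l0 divff// lt0r_neq0.
    by rewrite row_mxEr mxE.
  have bx i : be x 0 i = q i.
    rewrite /be row_mxKr; case: (split_ordP i) => k ->.
      rewrite row_mxEl ord1 mxE /q /r l0.
      by rewrite divff ?lt0r_neq0// mul1r subrr.
    by rewrite row_mxEr mxE.
  exists x => k; split=> [i|i j]; rewrite !ax ?bx//.
  have /line_meets_boxP-/(_ u_ge0)/(_ (ex_intro _ 0 (u0 0)))/(_ i j) := pu k.
  rewrite -[leLHS]mulrC -[leRHS]mulrC -ler_pdivrMr// mulrAC -ler_pdivlMr//.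
  rewrite -(ler_pM2l (u0 0)) /q /r; lra.
clearbody al be.
(* Solving t = al_i z_i + be_i for z_i gives this base point and direction. *)
exists (\row_i (- be x 0 i / al x 0 i)), (\row_i (al x 0 i)^-1).
have al0 := (Cx _ t0s).1.
split=> [i|t /Cx[_ xt]]; first by rewrite mxE invr_gt0.
apply/line_meets_boxP => [i||i j].
- by rewrite mxE invr_ge0; apply/ltW/al0.
- by exists 0; rewrite mxE invr_gt0; apply: al0.
rewrite !mxE.
rewrite -(ler_pM2l (al0 i)) -(ler_pM2l (al0 j)).
have ai : al x 0 i != 0 by rewrite lt0r_neq0.
have aj : al x 0 j != 0 by rewrite lt0r_neq0.
rewrite [leLHS](_ : _ = al x 0 i * a t 0 i + be x 0 i); last by field; rewrite ai aj.
by rewrite [leRHS](_ : _ = al x 0 j * b t 0 j + be x 0 j)//; field; rewrite ai aj.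
Qed.

(** * Fattening and compactness: directions with zero coordinates *)

(** Adding e / M to every direction coordinate moves the point of parameter [t k] by at most e in
    each coordinate, because M bounds the finitely many parameters. *)
Lemma perturb_line (R : realType) (d : nat) (I : finType)
    (a b : I -> 'rV[R]_d) (p u : 'rV[R]_d) (e : R) :
  0 < e -> (forall i, 0 <= u 0 i) ->
  (forall k, line_meets_box p u (a k) (b k)) ->
  exists u' : 'rV[R]_d, (forall i, 0 < u' 0 i) /\
    forall k, line_meets_box p u' (a k - const_mx e) (b k + const_mx e).
Proof.
move=> e0 u0 /choice[t ptu]; pose M := 1 + \sum_k `|t k|.
have M0 : 0 < M by rewrite ltr_pwDl// sumr_ge0.
have tM k : `|t k * (e / M)| <= e.
  rewrite normrM (gtr0_norm (divr_gt0 e0 M0)) mulrA ler_pdivrMr// mulrC.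
  rewrite ler_pM2l// /M (bigD1 k)//=.
  by rewrite addrCA lerDl addr_ge0// sumr_ge0.
exists (u + const_mx (e / M)); split=> [i|k].
  by rewrite !mxE ltr_wpDl// divr_gt0.
have [at_ tb] := ptu k; have := tM k; rewrite ler_norml => /andP[te et].
exists (t k); split=> i; have := at_ i; have := tb i; rewrite !mxE; lra.
Qed.

HB.instance Definition _ (T U : ptopologicalType) := Pointed.on (T * U)%type.

Lemma line_meets_box_reparam (R : realType) (d : nat) (p u a b : 'rV[R]_d)
    (s c : R) :
  c != 0 -> line_meets_box p u a b -> line_meets_box (p + s *: u) (c *: u) a b.
Proof.
move=> c0 [t pt]; exists ((t - s) / c).
by rewrite scalerA divfK// -addrA -scalerDl [s + _]addrC subrK.
Qed.

Lemma exists_pos_lb (R : realDomainType) (s : seq R) :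
  (forall x, x \in s -> 0 < x) -> exists2 e, 0 < e & forall x, x \in s -> e <= x.
Proof.
elim: s => [_|x s IH s0]; first by exists 1.
have [y ys|e e0 es] := IH; first by apply: s0; rewrite inE ys orbT.
exists (Num.min x e) => [|y].
  by rewrite lt_min e0 s0// mem_head.
rewrite inE => /predU1P[->|/es ey]; first by rewrite ge_min lexx.
by rewrite ge_min ey orbT.
Qed.

(** Fixing the coordinate sum at 1 keeps the limit of directions nonzero, and the weak inequalities
    pass to limits even when coordinates tend to 0. *)
Lemma closed_crossing_ineqs (R : realType) (d : nat) (a b : 'rV[R]_d) :
  closed [set pu : 'rV[R]_d * 'rV[R]_d | \sum_i pu.2 0 i = 1 /\
    forall i j, pu.2 0 j * (a 0 i - pu.1 0 i) <= pu.2 0 i * (b 0 j - pu.1 0 j)].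
Proof.
have c1 i : continuous (fun pu : 'rV[R]_d * 'rV[R]_d => pu.1 0 i).
  move=> x; have fstx : {for x, continuous (@fst 'rV[R]_d 'rV[R]_d)} by exact: cvg_fst.
  exact: continuous_comp fstx (@coord_continuous _ 1 d 0 i x.1).
have c2 i : continuous (fun pu : 'rV[R]_d * 'rV[R]_d => pu.2 0 i).
  move=> x; have sndx : {for x, continuous (@snd 'rV[R]_d 'rV[R]_d)} by exact: cvg_snd.
  exact: continuous_comp sndx (@coord_continuous _ 1 d 0 i x.2).
rewrite (_ : mkset _ =
  (fun pu : 'rV[R]_d * 'rV[R]_d => \sum_i pu.2 0 i) @^-1` [set x | x = 1] `&`
  \bigcap_ij ((fun pu : 'rV[R]_d * 'rV[R]_d => pu.2 0 ij.2 * (a 0 ij.1 - pu.1 0 ij.1)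
    - pu.2 0 ij.1 * (b 0 ij.2 - pu.1 0 ij.2)) @^-1` [set x | x <= 0])).
  apply: closedI.
    apply: preimage_closed; last exact: closed_eq.
    by move=> x _; apply: cvg_big => // [|i _]; [exact: add_continuous|exact: c2].
  apply: closed_bigI => -[i j] _; apply: preimage_closed; last exact: closed_le.
  move=> x _; apply: cvgB; apply: cvgM; try exact: c2.
    by apply: cvgB; [exact: cvg_cst|exact: c1].
  by apply: cvgB; [exact: cvg_cst|exact: c1].
apply/seteqP; split=> -[p u] /= [su ineq]; split=> //.
  by move=> [i j] _ /=; rewrite subr_le0.
by move=> i j; have := ineq (i, j) I; rewrite /= subr_le0.
Qed.

(** For each box and each fattening e > 0, the normalized lines satisfying the crossing inequalities
    form a closed set. Finitely many of these sets meet inside a compact set, by perturbation and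
    the positive case; a line common to all of them crosses every box, as e tends to 0. *)
Lemma santalo_nonneg (R : realType) (d : nat) (T : choiceType)
    (a b : T -> 'rV[R]_d.+1) (P : set T) :
  (forall f : 'I_(d + d).+1 -> T, (forall k, P (f k)) ->
    exists p u : 'rV[R]_d.+1, [/\ forall i, 0 <= u 0 i, exists i, 0 < u 0 i &
      forall k, line_meets_box p u (a (f k)) (b (f k))]) ->
  exists p u : 'rV[R]_d.+1, [/\ forall i, 0 <= u 0 i, exists i, 0 < u 0 i &
    forall t, P t -> line_meets_box p u (a t) (b t)].
Proof.
move=> Pf; have [[t0 Pt0]|nP] := pselect (exists t, P t); last first.
  exists 0, (const_mx 1); split=> [i||t Pt]; first by rewrite mxE.
    by exists 0; rewrite mxE.
  by case: nP; exists t.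
(* Base points are confined to the box of [t0] fattened by 1, directions to the unit cube. *)
pose K : set ('rV[R]_d.+1 * 'rV[R]_d.+1) :=
  [set v : 'rV[R]_d.+1 | forall i, `[a t0 0 i - 1, b t0 0 i + 1]%classic (v 0 i)] `*`
  [set v : 'rV[R]_d.+1 | forall i, `[0, 1]%classic (v 0 i)].
have Kcompact : compact K.
  by apply: compact_setX;
    [apply: (@rV_compact _ _ (fun i => `[a t0 0 i - 1, b t0 0 i + 1]%classic))
    |apply: (@rV_compact _ _ (fun=> `[0 : R, 1]%classic))] => i;
    apply: segment_compact.
pose G (te : T * R) := [set pu : 'rV[R]_d.+1 * 'rV[R]_d.+1 |
  \sum_i pu.2 0 i = 1 /\ forall i j,
    pu.2 0 j * ((a te.1 - const_mx te.2) 0 i - pu.1 0 i) <=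
    pu.2 0 i * ((b te.1 + const_mx te.2) 0 j - pu.1 0 j)].
pose D : set (T * R) := [set te | P te.1 /\ 0 < te.2].
have famG : closed_fam_of K D (fun te => K `&` G te).
  by exists G => // te _; apply: closed_crossing_ineqs.
have finG : finI D (fun te => K `&` G te).
  move=> D' D'D.
  have {}D'D (te : T * R) : te \in D' -> D te by move=> /D'D/set_mem.
  (* Including 1 forces e <= 1, so that the base point chosen below falls in [K]. *)
  have [x|e e0 eD] := @exists_pos_lb R (1 :: map snd D').
    by rewrite inE => /predU1P[->//|/mapP[te /D'D[_ ?] ->]].
  have [f fs|q [v [v0 qv]]] := @helly_positive_lines R d T
      (fun t => a t - const_mx e) (fun t => b t + const_mx e)
      (t0 :: map fst D').
    have [|p [u [u_ge0 _ pu]]] := Pf f.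
      move=> k; have := fs k; rewrite inE => /predU1P[->//|].
      by move=> /mapP[te /D'D[? _] ->].
    have [u' [u'0 pu']] := perturb_line e0 u_ge0 pu.
    by exists p, u'.
  have [s [as_ sb]] := qv t0 (mem_head _ _).
  have S0 : 0 < \sum_i v 0 i.
    by rewrite big_ord_recl ltr_pwDl// sumr_ge0// => i _; apply/ltW.
  (* The base point slides along the line into the fattened box of [t0], and the direction is
     divided by its sum. *)
  pose p := q + s *: v; pose u := (\sum_i v 0 i)^-1 *: v.
  have u0 i : 0 < u 0 i by rewrite mxE mulr_gt0// invr_gt0.
  have u1 : \sum_i u 0 i = 1.
    by under eq_bigr do rewrite mxE; rewrite -mulr_sumr mulVf// lt0r_neq0.
  have ule1 i : u 0 i <= 1.
    by rewrite -u1 (bigD1 i)//= lerDl sumr_ge0// => j _; apply/ltW.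
  have e1 : e <= 1 by apply: eD; rewrite mem_head.
  exists (p, u) => te teD'; split.
    split=> i; rewrite /= in_itv/=; last by rewrite ltW//=.
    have := as_ i; have := sb i; rewrite /p !mxE => *.
    by apply/andP; split; lra.
  split=> //= i j.
  have : line_meets_box p u (a te.1 - const_mx e) (b te.1 + const_mx e).
    apply: line_meets_box_reparam; first by rewrite invr_eq0 lt0r_neq0.
    by apply: qv; rewrite inE map_f ?orbT.
  have u_ge0 k : 0 <= u 0 k by apply/ltW.
  move=> /line_meets_boxP-/(_ u_ge0)/(_ (ex_intro _ 0 (u0 0)))/(_ i j).
  have ee : e <= te.2 by apply: eD; rewrite inE map_f ?orbT.
  clearbody p u; rewrite !mxE => h; apply: le_trans (le_trans h _).
    by rewrite ler_wpM2l//; lra.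
  by rewrite ler_wpM2l//; lra.
move: Kcompact; rewrite compact_In0 => /(_ _ D _ famG finG)[[p u] puG].
have [[/= _ u01] [/= u1 _]] := puG (t0, 1) (conj Pt0 ltr01).
have u0 i : 0 <= u 0 i by have := u01 i; rewrite in_itv/= => /andP[].
have ule1 i : u 0 i <= 1 by have := u01 i; rewrite in_itv/= => /andP[].
have upos : exists i, 0 < u 0 i.
  apply: contrapT => nu; have: \sum_i u 0 i = 0; last first.
    by rewrite u1 => /eqP; rewrite oner_eq0.
  apply: big1 => i _; apply/le_anti; rewrite u0 andbT leNgt.
  by apply/negP => ui; apply: nu; exists i.
exists p, u; split=> // t Pt; apply/line_meets_boxP => // i j.
(* Fattening by e / 2 costs (u_i + u_j) e / 2, at most e since the coordinates of [u] are at most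
   1. *)
apply/ler_addgt0Pr => e e0; have e2 : 0 < e / 2 by rewrite divr_gt0.
have [_ [_ /(_ i j)]] := puG (t, e / 2) (conj Pt e2).
have := ler_wpM2r (ltW e2) (ule1 i); have := ler_wpM2r (ltW e2) (ule1 j).
by rewrite /= !mxE; lra.
Qed.

(** * Sign patterns: lines of arbitrary direction *)

(** By contradiction: without a common line, every sign pattern has a bad family of 2d + 1 boxes.
    The union of these families still has a line by hypothesis, and the signs of its direction
    contradict the badness of one family. *)
Lemma santalo_lines (R : realType) (d : nat) (T : choiceType)
    (a b : T -> 'rV[R]_d.+1) (P : set T) :
  (forall f : 'I_(2 ^ d * (d + d).+1)%N -> T, (forall k, P (f k)) ->
    exists p u : 'rV[R]_d.+1, u != 0 /\
      forall k, line_meets_box p u (a (f k)) (b (f k))) ->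
  exists p u : 'rV[R]_d.+1, u != 0 /\
    forall t, P t -> line_meets_box p u (a t) (b t).
Proof.
move=> Pf.
(* Coordinate 0 is never reflected, since a direction may be replaced by its opposite; this leaves
   2^d patterns in dimension d + 1. *)
pose neg (s : {ffun 'I_d -> bool}) i :=
  if unlift ord0 i is Some k then s k else false.
pose lo s t : 'rV[R]_d.+1 := \row_i if neg s i then - b t 0 i else a t 0 i.
pose hi s t : 'rV[R]_d.+1 := \row_i if neg s i then - a t 0 i else b t 0 i.
pose refl s (v : 'rV[R]_d.+1) := \row_i if neg s i then - v 0 i else v 0 i.
have reflK s : involutive (refl s).
  by move=> v; apply/rowP => i; rewrite !mxE; case: (neg s i); rewrite ?opprK.
have meets_refl s t p u :
    line_meets_box p u (a t) (b t) ->
    line_meets_box (refl s p) (refl s u) (lo s t) (hi s t).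
  move=> [r [ra rb]]; exists r; split=> i; have := ra i; have := rb i;
    by rewrite !mxE; case: (neg s i) => *; lra.
have meets_refl' s t p u :
    line_meets_box p u (lo s t) (hi s t) ->
    line_meets_box (refl s p) (refl s u) (a t) (b t).
  move=> [r [ra rb]]; exists r; split=> i; have := ra i; have := rb i;
    by rewrite !mxE; case: (neg s i) => *; lra.
apply: contrapT => noline.
have /choice[f fP] s : exists f : 'I_(d + d).+1 -> T, (forall k, P (f k)) /\
    ~ exists p u : 'rV[R]_d.+1, [/\ forall i, 0 <= u 0 i, exists i, 0 < u 0 i &
      forall k, line_meets_box p u (lo s (f k)) (hi s (f k))].
  apply: contrapT => nf; apply: noline.
  have [f fP|p [u [_ [i ui] pu]]] := @santalo_nonneg R d T (lo s) (hi s) P.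
    by apply: contrapT => npu; apply: nf; exists f.
  exists (refl s p), (refl s u); split=> [|t /pu/meets_refl'//].
  apply: contraTneq ui => /(congr1 (refl s)); rewrite reflK => ->.
  by rewrite !mxE oppr0 if_same ltxx.
have cardE : (2 ^ d * (d + d).+1)%N = #|{: {ffun 'I_d -> bool} * 'I_(d + d).+1}|.
  by rewrite card_prod card_ffun card_bool !card_ord.
(* [g] concatenates the bad families of all patterns. *)
pose g k := let sj := enum_val (cast_ord cardE k) in f sj.1 sj.2.
have [k|p [v [v0 pv]]] := Pf g; first exact: (fP _).1.
have {v v0 pv} [u [u0 u00 pu]] : exists u : 'rV[R]_d.+1,
    [/\ u != 0, 0 <= u 0 0 & forall k, line_meets_box p u (a (g k)) (b (g k))].
  have [v00|v00] := leP 0 (v 0 0); first by exists v.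
  exists (- v); split=> [||k]; first by rewrite oppr_eq0.
    by rewrite mxE oppr_ge0 ltW.
  have := @line_meets_box_reparam _ _ _ _ _ _ 0 (- 1) _ (pv k).
  by rewrite scale0r addr0 scaleN1r; apply; rewrite oppr_eq0 oner_eq0.
pose s := [ffun k : 'I_d => u 0 (lift ord0 k) < 0].
have ru i : 0 <= refl s u 0 i.
  rewrite mxE /neg; case: unliftP => [k ->|->//]; rewrite ffunE.
  by case: ltP => [/ltW|//]; rewrite oppr_ge0.
case: (fP s) => _; apply; exists (refl s p), (refl s u); split=> // [|k].
  have : refl s u != 0.
    by apply: contra u0 => /eqP/(congr1 (refl s)); rewrite reflK => ->;
      apply/eqP/rowP => i; rewrite !mxE oppr0 if_same.
  by case/rV0Pn => i ri; exists i; rewrite lt0r ri ru.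
apply: meets_refl.
have := pu (cast_ord (esym cardE) (enum_rank (s, k))).
by rewrite /g cast_ordKV enum_rankK.
Qed.

(** * Duality between flats and lines of coefficient vectors *)

Lemma dim_hyperplane (R : realType) (d : nat) (a : 'rV[R]_d) :
  \dim (hyperplane a) = d.
Proof. by have := proj_dim_hyperplane a => /addIr[]. Qed.

Lemma mem_hyperplane_mx (R : realType) (d : nat) (a : 'rV[R]_d)
    (v : 'rV[R]_(d + 1)) :
  (v \in hyperplane a) = (lsubmx v *m a^T == rsubmx v).
Proof.
rewrite -{1}[v]hsubmxK memv_ker lfunE /= mul_row_col mulmxN mulmx1.
by rewrite subr_eq0.
Qed.

(** If two distinct hyperplanes contain [L], the first is spanned by [L] and a vector [w] outside
    the second, so the value at [w] of the equation of [h] locates [h] on the line through [h0] and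
    [h1]. If at most one contains [L], any direction will do. *)
Lemma flat_in_pencil (R : realType) (d : nat) (L : flat R d.+1) :
  \dim L = d ->
  exists p u, u != 0 /\
    forall h, (L <= hyperplane h)%VS -> exists t, h = p + t *: u.
Proof.
move=> dimL.
have [[h0 [h1 [Lh0 Lh1 h01]]]|small] := pselect (exists h0 h1,
    [/\ (L <= hyperplane h0)%VS, (L <= hyperplane h1)%VS & h0 != h1]); last first.
  have c1 : const_mx 1 != 0 :> 'rV[R]_d.+1.
    by apply/rV0Pn; exists 0; rewrite mxE oner_neq0.
  have [[p Lp]|nL] := pselect (exists p, (L <= hyperplane p)%VS).
    exists p, (const_mx 1); split=> // h Lh; exists 0; rewrite scale0r addr0.
    by apply/eqP/negPn/negP => hp; apply: small; exists h, p.
  by exists 0, (const_mx 1); split=> // h Lh; case: nL; exists h.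
exists h0, (h1 - h0); split=> [|h Lh]; first by rewrite subr_eq0 eq_sym.
have /subvPn[w wh0 wh1] : ~~ (hyperplane h0 <= hyperplane h1)%VS.
  apply: contra h01 => le01; apply/eqP/hyperplane_inj/eqP.
  by rewrite eqEdim le01 !dim_hyperplane /=.
have h0E : (L + <[w]>)%VS = hyperplane h0.
  apply/eqP; rewrite eqEdim subv_add Lh0 -memvE wh0 dim_hyperplane.
  rewrite dimv_disjoint_sum ?dimL ?dim_vline.
    have -> : w != 0 by apply: contraNneq wh1 => ->; rewrite mem0v.
    by rewrite /= addn1.
  apply/eqP; rewrite -subv0; apply/subvP => v; rewrite memv_cap => /andP[vL].
  case/vlineP => k vE; move: vL; rewrite {}vE memv0.
  have [->|k0] := eqVneq k 0; first by rewrite scale0r.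
  by rewrite rpredZeq (negbTE k0) /= => /(subvP Lh1); rewrite (negbTE wh1).
move: wh1; rewrite mem_hyperplane_mx -subr_eq0.
move: (wh0); rewrite mem_hyperplane_mx => /eqP wE0.
set c := _ - rsubmx w => c0.
(* The equation of [h0] vanishes at [w], so t is the ratio of the values there of the equations of
   [h] and [h1]. *)
have [t tE] : exists t, lsubmx w *m h^T - rsubmx w = t *: c.
  exists ((lsubmx w *m h^T - rsubmx w) 0 0 / c 0 0).
  have c00 : c 0 0 != 0.
    apply: contraNneq c0 => c00; apply/eqP/matrixP => i j.
    by rewrite !ord1 c00 mxE.
  by apply/matrixP => i j; rewrite !ord1 [RHS]mxE divfK.
exists t; apply: trmx_inj; apply/row_matrixP => j; rewrite !rowE.
move: (delta_mx 0 j) => z.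
(* [z] is lifted to [hyperplane h0] and split along [L] and [w]; on the part in [L], the vectors
   [h], [h0] and [h1] agree. *)
have : row_mx z (z *m h0^T) \in (L + <[w]>)%VS.
  by rewrite h0E mem_hyperplane_mx row_mxKl row_mxKr.
case/memv_addP => l lL [_ /vlineP[k ->] zE].
have lE a : (L <= hyperplane a)%VS -> lsubmx l *m a^T = rsubmx l.
  by move=> /subvP/(_ _ lL); rewrite mem_hyperplane_mx => /eqP.
have -> : z = lsubmx l + k *: lsubmx w.
  by move/(congr1 lsubmx): zE; rewrite row_mxKl linearD linearZ.
rewrite linearD linearZ linearB /= mulmxDr -scalemxAr mulmxBr !mulmxDl -!scalemxAl.
rewrite !lE// wE0 -addrA; congr (_ + _).
rewrite opprD addrACA subrr add0r -scalerBr scalerA mulrC -scalerA -/c -tE.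
by rewrite -scalerDr addrC subrK.
Qed.

(** Two distinct hyperplanes of the pencil together span the whole space, which gives the dimension
    of their intersection; the other equations are affine combinations of these two. *)
Lemma line_of_hyperplanes (R : realType) (d : nat) (p u : 'rV[R]_d.+1) :
  u != 0 ->
  exists L : flat R d.+1, [/\ \dim L = d, avoids_origin L &
    forall t, (L <= hyperplane (p + t *: u))%VS].
Proof.
move=> u0; exists (hyperplane p :&: hyperplane (p + u))%VS; split.
- have full : \dim (hyperplane p + hyperplane (p + u)) = d.+2.
    apply/eqP; rewrite eqn_leq; apply/andP; split.
      by apply: leq_trans (dimvS (subvf _)) _; rewrite dimvf /dim /= mul1n addn1.
    rewrite ltnNge; apply/negP => le_dim.
    have /addv_idPl pu_p :
        (hyperplane p + hyperplane (p + u))%VS = hyperplane p.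
      by apply/esym/eqP; rewrite eqEdim addvSl dim_hyperplane.
    have : hyperplane (p + u) = hyperplane p.
      by apply/eqP; rewrite eqEdim pu_p !dim_hyperplane /=.
    move/hyperplane_inj/eqP; rewrite -subr_eq0 addrAC subrr add0r.
    exact/negP.
  have := dimv_sum_cap (hyperplane p) (hyperplane (p + u)).
  rewrite full !dim_hyperplane; lia.
- by rewrite /avoids_origin memv_cap (negbTE (hyperplane_avoids_origin p)).
move=> t; apply/subvP => v; rewrite memv_cap !mem_hyperplane_mx.
rewrite !linearD !linearZ /= => /andP[/eqP -> /eqP].
by move/(canRL (addKr _)); rewrite addNr => ->; rewrite scaler0 addr0.
Qed.

(** * Transfer from lines and boxes to transversal flats *)

Theorem theorem23 (R : realType) (d : nat) (F : set (set (flat R d))) :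
  (0 < d)%N ->
  (forall X, F X -> is_starbox X) ->
  (forall G : set (set (flat R d)),
      G `<=` F -> G #<= `I_(2 ^ (d - 1) * (2 * d - 1))%N ->
      exists L : flat R d, star_transversal L G) ->
  exists L : flat R d, star_transversal L F.
Proof.
case: d F => // d F _ boxF FG.
have /choice[ab abE] X : exists ab : 'rV[R]_d.+1 * 'rV[R]_d.+1,
    F X -> X = starbox ab.1 ab.2.
  have [/boxF[a [b [_ ->]]]|nFX] := pselect (F X); first by exists (a, b).
  (* Sets outside [F] receive arbitrary corners. *)
  by exists (0, 0).
have [f Ff|p [u [u0 pu]]] := @santalo_lines R d (set (flat R d.+1))
    (fun X => (ab X).1) (fun X => (ab X).2) F.
  have [||L [dimL L0 LG]] := FG (range f).
  - by move=> _ [k _ <-]; apply: Ff.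
  (* [f] may repeat boxes, so its range has at most as many members as its domain. *)
  - apply: card_le_trans (card_image_le _ _) _.
    have -> : (2 ^ (d.+1 - 1) * (2 * d.+1 - 1) = 2 ^ d * (d + d).+1)%N.
      by rewrite mul2n -addnn addnS !subn1.
    by rewrite -(card_le_eql card_II).
  have {}dimL : \dim L = d by move: dimL; rewrite /proj_dim; lia.
  have [p [u [u0 pu]]] := flat_in_pencil dimL.
  exists p, u; split=> // k.
  have [|H] := LG (f k); first by exists k.
  rewrite {1}(abE _ (Ff k)) => -[h [ah hb] <-] /pu[t hE].
  by exists t; rewrite -hE.
have [L [dimL L0 Lpu]] := line_of_hyperplanes p u0.
exists L; split=> // [|X FX]; first by rewrite /proj_dim dimL; lia.
have [t [pa pb]] := pu X FX.
exists (hyperplane (p + t *: u)) => //.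
by rewrite (abE X FX); exists (p + t *: u).
Qed.
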